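(* Let $X$ be a Banach space, $\tau:\mathcal D\to\mathcal D$ injective, $0<p\le2$ and $0<q\le p$. Then $$\|T_{\tau,q}\otimes\mathrm{Id}_X\|_q\le A_q\,C_1^{\frac1q-\frac1p}\,\|T_{\tau,p}\otimes\mathrm{Id}_X\|_p,$$ where $C_1=\sup_{\mathcal H\subseteq\tau(\mathcal D)}\frac{1}{|\sigma(\mathcal H)^*|}\int_0^1\mu_{\mathcal H}(t)\,dt$ and $A_q>0$ depends only on $q$ (through the constants of the atomic decomposition of $H^q_X$).
   Context: $\mathcal D$ is the collection of dyadic subintervals $[(k-1)2^{-n},k2^{-n})$ ($n\ge0$, $1\le k\le 2^n$) of $[0,1)$, $|I|$ Lebesgue measure; for a collection $\mathcal E$, $\mathcal E^*=\bigcup_{I\in\mathcal E}I$. $h_I$ is the Haar function ($1$ on the left half of $I$, $-1$ on the right half, $0$ outside). $\sigma=\tau^{-1}:\tau(\mathcal D)\to\mathcal D$, and for $\mathcal H\subseteq\tau(\mathcal D)$, $\mu_{\mathcal H}(t)=\sup_{I\in\mathcal H}\frac{|\sigma(I)|}{|I|}\mathbf 1_I(t)$. For a finite $X$-valued Haar series $f=\sum_Ix_Ih_I$ let $\mathbb S(f)(t)=\big(\int_0^1\|\sum_Ir_I(s)x_Ih_I(t)\|_X^2ds\big)^{1/2}$ with $(r_I)$ independent Rademacher functions, and $\|f\|_{H^p_X}=\|\mathbb S(f)\|_{L^p[0,1]}$ ($0<p<\infty$); $H^p_X$ is the completion. The rearrangement operator is $(T_{\tau,p}\otimes\mathrm{Id}_X)(\sum_Ix_Ih_I)=\sum_Ix_I(|I|/|\tau(I)|)^{1/p}h_{\tau(I)}$,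 and $\|T_{\tau,p}\otimes\mathrm{Id}_X\|_p$ is the supremum of $\|(T_{\tau,p}\otimes\mathrm{Id}_X)f\|_{H^p_X}$ over all $f$ with finite Haar support and $\|f\|_{H^p_X}\le1$. *)

(* Defs.v *)
From Stdlib Require Import Reals Lra Lia List.
Import ListNotations.
Open Scope R_scope.

Record BanachSpace := {
  bcar :> Type;
  bzero : bcar;
  badd : bcar -> bcar -> bcar;
  bopp : bcar -> bcar;
  bscal : R -> bcar -> bcar;
  bnorm : bcar -> R;
  badd_assoc : forall x y z, badd x (badd y z) = badd (badd x y) z;
  badd_comm : forall x y, badd x y = badd y x;
  badd_zero_r : forall x, badd x bzero = x;
  badd_opp_r : forall x, badd x (bopp x) = bzero;
  bscal_assoc : forall a b x, bscal a (bscal b x) = bscal (a * b) x;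
  bscal_one : forall x, bscal 1 x = x;
  bscal_distr_l : forall a x y, bscal a (badd x y) = badd (bscal a x) (bscal a y);
  bscal_distr_r : forall a b x, bscal (a + b) x = badd (bscal a x) (bscal b x);
  bnorm_eq0 : forall x, bnorm x = 0 -> x = bzero;
  bnorm_scal : forall a x, bnorm (bscal a x) = Rabs a * bnorm x;
  bnorm_triangle : forall x y, bnorm (badd x y) <= bnorm x + bnorm y;
  bcomplete : forall u : nat -> bcar,
    (forall eps, 0 < eps -> exists N, forall m n, (N <= m)%nat -> (N <= n)%nat ->
        bnorm (badd (u m) (bopp (u n))) < eps) ->
    exists l, forall eps, 0 < eps -> exists N, forall n, (N <= n)%nat ->
        bnorm (badd (u n) (bopp l)) < eps
}.

(** * Dyadic intervals: mkDyad n k _ is [k 2^-n, (k+1) 2^-n), 0 <= k < 2^n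
    (k is zero-based; the paper's k corresponds to k+1). *)
Record dyad := mkDyad {
  dlev : nat;
  dpos : nat;
  dpos_lt : Nat.ltb dpos (2 ^ dlev)%nat = true
}.

Definition dlen (I : dyad) : R := / 2 ^ dlev I.
Definition dleft (I : dyad) : R := INR (dpos I) * dlen I.

Definition in_dyadb (I : dyad) (t : R) : bool :=
  if Rle_dec (dleft I) t then
    if Rlt_dec t (dleft I + dlen I) then true else false
  else false.

Definition haar (I : dyad) (t : R) : R :=
  if Rle_dec (dleft I) t then
    if Rlt_dec t (dleft I + dlen I / 2) then 1
    else if Rlt_dec t (dleft I + dlen I) then -1 else 0
  else 0.

(** x^a for x >= 0 with the convention 0^a = 0 (a > 0). *)
Definition rpow (x a : R) : R := if Rle_dec x 0 then 0 else Rpower x a.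

Definition Rsum (l : list R) : R := fold_right Rplus 0 l.

(** Exact integral over [0,1] of a function constant on each dyadic
    interval of level m (evaluated at midpoints). *)
Definition dyadic_int (m : nat) (g : R -> R) : R :=
  Rsum (map (fun j => g ((INR j + / 2) / 2 ^ m) / 2 ^ m) (seq 0 (2 ^ m)%nat)).

Definition maxlev (l : list dyad) : nat := fold_right Nat.max 0%nat (map dlev l).

(** * Finite X-valued Haar series: a list of pairs (I, x_I) with distinct I,
    representing sum_I x_I h_I. *)
Definition haar_series (X : BanachSpace) := list (dyad * X).
Definition valid_series {X : BanachSpace} (f : haar_series X) : Prop :=
  NoDup (map fst f).

Definition vsum (X : BanachSpace) (l : list X) : X := fold_right (badd X) (bzero X) l.

Fixpoint sign_lists (n : nat) : list (list R) :=
  match n with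
  | O => [ [] ]
  | S n' => flat_map (fun s => [1 :: s; -1 :: s]) (sign_lists n')
  end.

Definition signed_eval (X : BanachSpace) (f : haar_series X) (eps : list R) (t : R) : X :=
  vsum X (map (fun ex => bscal X (fst ex * haar (fst (snd ex)) t) (snd (snd ex)))
              (combine eps f)).

(** Square function S(f)(t): the Rademacher integral over s in [0,1] equals the
    average over all sign choices (r_I independent, symmetric +-1). *)
Definition Sfun (X : BanachSpace) (f : haar_series X) (t : R) : R :=
  sqrt (Rsum (map (fun eps => (bnorm X (signed_eval X f eps t)) ^ 2)
                  (sign_lists (length f))) / 2 ^ (length f)).

(** ||f||_{H^p_X} = ||S(f)||_{L^p[0,1]}; S(f) is constant on dyadic intervals
    of level 1 + (max level in the support). *)
Definition Hnorm (X : BanachSpace) (p : R) (f : haar_series X) : R :=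
  rpow (dyadic_int (S (maxlev (map fst f))) (fun t => rpow (Sfun X f t) p)) (/ p).

Definition rearr (X : BanachSpace) (tau : dyad -> dyad) (p : R) (f : haar_series X)
  : haar_series X :=
  map (fun Ix => (tau (fst Ix),
                  bscal X (rpow (dlen (fst Ix) / dlen (tau (fst Ix))) (/ p)) (snd Ix))) f.

Definition opbound (X : BanachSpace) (tau : dyad -> dyad) (p M : R) : Prop :=
  forall f : haar_series X, valid_series f -> Hnorm X p f <= 1 ->
    Hnorm X p (rearr X tau p f) <= M.

(** For a finite H = tau(G) (G = sigma(H)): mu_H(t). *)
Definition mu (tau : dyad -> dyad) (G : list dyad) (t : R) : R :=
  fold_right Rmax 0
    (map (fun I => if in_dyadb (tau I) t then dlen I / dlen (tau I) else 0) G).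

Definition union_meas (G : list dyad) : R :=
  dyadic_int (maxlev G) (fun t => if existsb (fun I => in_dyadb I t) G then 1 else 0).

Definition C1_bound (tau : dyad -> dyad) (M : R) : Prop :=
  forall G : list dyad, G <> [] ->
    dyadic_int (maxlev (map tau G)) (mu tau G) / union_meas G <= M.

(* Main.v *)
Require Import Defs.
From Stdlib Require Import Reals Lra Lia List Bool Arith.
Import ListNotations.
Open Scope R_scope.

(** For a Haar series [f] let [s I] be the constant value on [I] of the square
    function of the part of [f] supported on the dyadic intervals containing
    [I], so that [s I <= S(f)] on [I], and put [a = q / p <= 1].  The series
    [g = sum_I a (s I)^(a - 1) x_I h_I] satisfies [S(g) <= S(f)^a] pointwise:
    this is Abel summation along the chain of intervals containing a point.
    Hence [||f||_q <= 1] implies [||g||_p <= 1].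

    Conversely the contraction principle gives
    [S(T_q f) <= (p / q) N^(1/q - 1/p) S(T_p g)], where [N (t)] is the maximum of
    [(s I)^q |I| / |tau I|] over the [I] with [t] in [tau I].  Applying the
    definition of [C_1] to the collections [{I : s I >= c}] and integrating over
    the levels gives [int N <= C_1 int S(f)^q], and Young's inequality (in place
    of Hölder's, everything being normalised) concludes with [A_q = 2 / q]. *)

(** * Powers *)

Lemma Rpower_pos (x a : R) : 0 < Rpower x a.
Proof. apply exp_pos. Qed.

Lemma rpow_nonneg (x a : R) : 0 <= rpow x a.
Proof.
  unfold rpow; destruct (Rle_dec x 0); [lra | left; apply Rpower_pos].
Qed.

Lemma rpow_pos_eq (x a : R) : 0 < x -> rpow x a = Rpower x a.
Proof. intros Hx; unfold rpow; destruct (Rle_dec x 0); [lra | reflexivity]. Qed.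

Lemma rpow_nonpos_eq (x a : R) : x <= 0 -> rpow x a = 0.
Proof. intros Hx; unfold rpow; destruct (Rle_dec x 0); [reflexivity | lra]. Qed.

Lemma rpow_le (x y a : R) : 0 <= a -> x <= y -> rpow x a <= rpow y a.
Proof.
  intros Ha Hxy.
  destruct (Rle_lt_dec x 0) as [Hx | Hx].
  - rewrite (rpow_nonpos_eq x) by assumption; apply rpow_nonneg.
  - rewrite !rpow_pos_eq by lra; apply Rle_Rpower_l; [assumption | lra].
Qed.

Lemma rpow_rpow (x a b : R) : rpow (rpow x a) b = rpow x (a * b).
Proof.
  destruct (Rle_lt_dec x 0) as [Hx | Hx].
  - rewrite !(rpow_nonpos_eq x), rpow_nonpos_eq by lra; reflexivity.
  - rewrite !(rpow_pos_eq x) by assumption.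
    rewrite rpow_pos_eq by apply Rpower_pos; apply Rpower_mult.
Qed.

Lemma rpow_1 (x : R) : 0 <= x -> rpow x 1 = x.
Proof.
  intros [Hx | <-].
  - rewrite rpow_pos_eq by assumption; apply Rpower_1; assumption.
  - apply rpow_nonpos_eq; lra.
Qed.

Lemma rpow_inv_le (x y a : R) : 0 < a -> 0 <= x -> 0 <= y ->
  rpow x (/ a) <= y -> x <= rpow y a.
Proof.
  intros Ha Hx Hy H.
  apply (rpow_le _ _ a) in H; [| lra].
  rewrite rpow_rpow, Rinv_l, rpow_1 in H by lra; assumption.
Qed.

Lemma rpow_inv_le_of_le (x y a : R) : 0 < a -> 0 <= y ->
  x <= rpow y a -> rpow x (/ a) <= y.
Proof.
  intros Ha Hy H.
  apply (rpow_le _ _ (/ a)) in H; [| left; apply Rinv_0_lt_compat; lra].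
  rewrite rpow_rpow, Rinv_r, rpow_1 in H by lra; assumption.
Qed.

(** Young's inequality, from the tangent line of [exp] at the weighted mean [c] of the logarithms.
    In the weighted sum of the two tangent bounds the linear terms cancel and leave [exp c]. *)
Lemma weighted_AMGM (x y a : R) : 0 < x -> 0 < y -> 0 <= a <= 1 ->
  Rpower x (1 - a) * Rpower y a <= (1 - a) * x + a * y.
Proof.
  intros Hx Hy Ha; unfold Rpower; rewrite <- exp_plus.
  set (c := (1 - a) * ln x + a * ln y).
  assert (Ht : forall z, 0 < z -> exp c * (1 + (ln z - c)) <= z).
  { intros z Hz.
    replace z with (exp c * exp (ln z - c)) at 2
      by (rewrite <- exp_plus, Rplus_minus; apply exp_ln; assumption).
    apply Rmult_le_compat_l; [left; apply exp_pos | apply exp_ineq1_le]. }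
  assert (Hx' := Rmult_le_compat_l (1 - a) _ _ ltac:(lra) (Ht x Hx)).
  assert (Hy' := Rmult_le_compat_l a _ _ ltac:(lra) (Ht y Hy)).
  replace (exp c) with ((1 - a) * (exp c * (1 + (ln x - c)))
                        + a * (exp c * (1 + (ln y - c))))
    by (unfold c; ring).
  lra.
Qed.

(** Concavity of [z^a / a], whose derivative at [y] is [y^(a - 1)]: the graph lies below its
    tangent. This is [weighted_AMGM] multiplied by [y^(a - 1)]. *)
Lemma Rpower_tangent (x y a : R) : 0 < x -> 0 < y -> 0 < a <= 1 ->
  Rpower y (a - 1) * (y - x) <= Rpower y a / a - Rpower x a / a.
Proof.
  intros Hx Hy Ha.
  assert (H := weighted_AMGM y x a Hy Hx ltac:(lra)).
  apply (Rmult_le_compat_l (Rpower y (a - 1))) in H; [| left; apply Rpower_pos].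
  rewrite <- Rmult_assoc, <- Rpower_plus in H.
  replace (a - 1 + (1 - a)) with 0 in H by ring.
  rewrite Rpower_O, Rmult_1_l in H by assumption.
  assert (Hya : Rpower y a = Rpower y (a - 1) * y).
  { rewrite <- (Rpower_1 y) at 3 by assumption.
    rewrite <- Rpower_plus; f_equal; ring. }
  apply (Rmult_le_reg_l a); [lra |].
  replace (a * (Rpower y a / a - Rpower x a / a)) with (Rpower y a - Rpower x a)
    by (field; lra).
  rewrite Hya; lra.
Qed.

Lemma Rpower_anti (x y a : R) : 0 < x <= y -> a <= 1 -> Rpower y (a - 1) <= Rpower x (a - 1).
Proof.
  intros Hxy Ha; replace (a - 1) with (- (1 - a)) by ring; rewrite !Rpower_Ropp.
  apply Rinv_le_contravar; [apply Rpower_pos | apply Rle_Rpower_l; lra].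
Qed.

Lemma rpow_one_l (a : R) : rpow 1 a = 1.
Proof. rewrite rpow_pos_eq by lra; unfold Rpower; rewrite ln_1, Rmult_0_r; apply exp_0. Qed.

(** * Finite sums, maxima and dyadic integrals *)

Section Sums.
Variable A : Type.
Implicit Types (l : list A) (F G : A -> R).

Lemma Rsum_map_le l F G : (forall x, In x l -> F x <= G x) ->
  Rsum (map F l) <= Rsum (map G l).
Proof.
  induction l as [| x l IH]; simpl; intros H; [lra |].
  apply Rplus_le_compat; [apply H; auto | apply IH; auto].
Qed.

Lemma Rsum_map_plus l F G :
  Rsum (map (fun x => F x + G x) l) = Rsum (map F l) + Rsum (map G l).
Proof. induction l as [| x l IH]; simpl; [| rewrite IH]; ring. Qed.

Lemma Rsum_map_scal l F c : Rsum (map (fun x => c * F x) l) = c * Rsum (map F l).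
Proof. induction l as [| x l IH]; simpl; [| rewrite IH]; ring. Qed.

Lemma Rsum_map_nonneg l F : (forall x, In x l -> 0 <= F x) -> 0 <= Rsum (map F l).
Proof.
  induction l as [| x l IH]; simpl; intros H; [lra |].
  apply Rplus_le_le_0_compat; [apply H; auto | apply IH; auto].
Qed.

Lemma Rsum_map_pos l F x : (forall y, In y l -> 0 <= F y) -> In x l -> 0 < F x ->
  0 < Rsum (map F l).
Proof.
  intros H Hin Hx; induction l as [| y l IH]; [destruct Hin |].
  simpl; destruct Hin as [-> | Hin].
  - apply Rplus_lt_le_0_compat; [assumption |].
    apply Rsum_map_nonneg; intros; apply H; simpl; auto.
  - apply Rplus_le_lt_0_compat; [apply H; simpl; auto |].
    apply IH; [intros; apply H; simpl; auto | assumption].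
Qed.

(** Minkowski's inequality in l^2. After squaring, induction on the list needs Cauchy-Schwarz only
    in the plane. *)
Lemma sqrt_sum_triangle l F G H :
  (forall x, 0 <= F x <= G x + H x) -> (forall x, 0 <= G x) -> (forall x, 0 <= H x) ->
  sqrt (Rsum (map (fun x => F x ^ 2) l))
  <= sqrt (Rsum (map (fun x => G x ^ 2) l)) + sqrt (Rsum (map (fun x => H x ^ 2) l)).
Proof.
  intros HF HG HH.
  assert (Hs : forall K, 0 <= Rsum (map (fun x => K x ^ 2) l))
    by (intros K; apply Rsum_map_nonneg; intros; apply pow2_ge_0).
  rewrite <- (sqrt_Rsqr (sqrt (Rsum (map (fun x => G x ^ 2) l))
                         + sqrt (Rsum (map (fun x => H x ^ 2) l))))
    by (apply Rplus_le_le_0_compat; apply sqrt_pos).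
  apply sqrt_le_1_alt; clear Hs; unfold Rsqr.
  induction l as [| x l IH]; cbn [map Rsum fold_right]; [rewrite sqrt_0; lra |].
  fold (Rsum (map (fun x => F x ^ 2) l)) (Rsum (map (fun x => G x ^ 2) l))
    (Rsum (map (fun x => H x ^ 2) l)).
  assert (Hs : forall K, 0 <= Rsum (map (fun x => K x ^ 2) l))
    by (intros K; apply Rsum_map_nonneg; intros; apply pow2_ge_0).
  assert (HU := Hs G); assert (HV := Hs H).
  set (U := Rsum (map (fun x => G x ^ 2) l)) in *.
  set (V := Rsum (map (fun x => H x ^ 2) l)) in *.
  specialize (HF x); specialize (HG x); specialize (HH x).
  set (g := G x) in *; set (h := H x) in *.
  assert (EU := sqrt_sqrt U HU); assert (EV := sqrt_sqrt V HV).
  assert (PU := sqrt_pos U); assert (PV := sqrt_pos V).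
  assert (EU' := sqrt_sqrt (g ^ 2 + U) ltac:(nra)).
  assert (EV' := sqrt_sqrt (h ^ 2 + V) ltac:(nra)).
  assert (PU' := sqrt_pos (g ^ 2 + U)); assert (PV' := sqrt_pos (h ^ 2 + V)).
  set (u := sqrt U) in *; set (v := sqrt V) in *.
  set (u' := sqrt (g ^ 2 + U)) in *; set (v' := sqrt (h ^ 2 + V)) in *.
  (* Cauchy-Schwarz for the vectors [(g, u)] and [(h, v)], whose lengths are [u'] and [v']. *)
  assert (HCS : g * h + u * v <= u' * v').
  { apply Rsqr_incr_0_var; [| nra]; unfold Rsqr.
    replace (u' * v' * (u' * v')) with ((g ^ 2 + U) * (h ^ 2 + V))
      by (rewrite <- EU', <- EV'; ring).
    rewrite <- EU, <- EV; assert (0 <= (g * v - u * h) ^ 2) by apply pow2_ge_0; nra. }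
  assert (F x ^ 2 <= (g + h) ^ 2) by (apply pow_incr; assumption).
  nra.
Qed.

(** The floor 0 matches that of [mu], which is convertible to an instance of this; later [change]
    steps rely on it. *)
Definition maxmap l F : R := fold_right Rmax 0 (map F l).

Lemma maxmap_nonneg l F : 0 <= maxmap l F.
Proof.
  induction l as [| x l IH]; unfold maxmap in *; simpl; [lra |].
  eapply Rle_trans; [apply IH | apply Rmax_r].
Qed.

Lemma le_maxmap l F x : In x l -> F x <= maxmap l F.
Proof.
  induction l as [| y l IH]; unfold maxmap in *; simpl; [tauto |].
  intros [-> | H]; [apply Rmax_l |].
  eapply Rle_trans; [apply IH, H | apply Rmax_r].
Qed.

Lemma maxmap_attained l F : maxmap l F = 0 \/ exists x, In x l /\ maxmap l F = F x.
Proof.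
  induction l as [| y l IH]; unfold maxmap in *; simpl; [auto |].
  unfold Rmax at 1 3; destruct (Rle_dec (F y) _) as [H | H].
  - destruct IH as [-> | [x [Hx ->]]]; [auto | right; exists x; auto].
  - right; exists y; auto.
Qed.

Lemma maxmap_le l F c : 0 <= c -> (forall x, In x l -> F x <= c) -> maxmap l F <= c.
Proof.
  intros Hc H; destruct (maxmap_attained l F) as [-> | [x [Hx ->]]]; auto.
Qed.

Lemma exists_argmax l F : l <> [] ->
  exists x, In x l /\ forall y, In y l -> F y <= F x.
Proof.
  induction l as [| x l IH]; intros Hl; [tauto |].
  destruct l as [| z l'].
  - exists x; split; [simpl; auto | intros y [-> | []]; lra].
  - destruct IH as [y [Hy Hm]]; [discriminate |].
    destruct (Rle_lt_dec (F x) (F y)).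
    + exists y; split; [right; assumption |].
      intros u [<- | Hu]; [assumption | apply Hm, Hu].
    + exists x; split; [left; reflexivity |].
      intros u [<- | Hu]; [lra | specialize (Hm u Hu); lra].
Qed.

(** Makes the number of selected intervals decrease in the two strong inductions below, where an
    extremal element is discarded. *)
Lemma filter_length_lt l (P P' : A -> bool) x :
  (forall y, P y = true -> P' y = true) -> In x l -> P x = false -> P' x = true ->
  (length (filter P l) < length (filter P' l))%nat.
Proof.
  intros HP Hin Hx Hx'.
  assert (Hle : forall l', (length (filter P l') <= length (filter P' l'))%nat).
  { induction l' as [| y l' IH]; simpl; [lia |].
    destruct (P y) eqn:E; [rewrite (HP y E); simpl; lia |].
    destruct (P' y); simpl; lia. }
  induction l as [| y l IH]; [destruct Hin |]; simpl.
  destruct Hin as [-> | Hin].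
  - rewrite Hx, Hx'; simpl; specialize (Hle l); lia.
  - specialize (IH Hin); destruct (P y) eqn:E; [rewrite (HP y E); simpl; lia |].
    destruct (P' y); simpl; lia.
Qed.
End Sums.

(** * Midpoint sums over dyadic cells, and their independence of the level *)

Lemma pow2_pos (n : nat) : 0 < 2 ^ n.
Proof. apply pow_lt; lra. Qed.

Lemma dyadic_int_le m (g h : R -> R) : (forall t, g t <= h t) ->
  dyadic_int m g <= dyadic_int m h.
Proof.
  intros H; apply Rsum_map_le; intros j _.
  apply Rmult_le_compat_r; [left; apply Rinv_0_lt_compat, pow2_pos | apply H].
Qed.

Lemma dyadic_int_lincomb m a b (g h : R -> R) :
  dyadic_int m (fun t => a * g t + b * h t) = a * dyadic_int m g + b * dyadic_int m h.
Proof.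
  unfold dyadic_int; rewrite <- !Rsum_map_scal, <- Rsum_map_plus; f_equal.
  apply map_ext; intros j; field; apply Rgt_not_eq, pow2_pos.
Qed.

Lemma dyadic_int_nonneg m g : (forall t, 0 <= g t) -> 0 <= dyadic_int m g.
Proof.
  intros H; apply Rsum_map_nonneg; intros j _.
  apply Rmult_le_pos; [apply H | left; apply Rinv_0_lt_compat, pow2_pos].
Qed.

Lemma dyadic_int_pos m g j : (forall t, 0 <= g t) -> (j < 2 ^ m)%nat ->
  0 < g ((INR j + / 2) / 2 ^ m) -> 0 < dyadic_int m g.
Proof.
  intros H Hj Hg; apply Rsum_map_pos with j.
  - intros i _; apply Rmult_le_pos; [apply H | left; apply Rinv_0_lt_compat, pow2_pos].
  - apply in_seq; lia.
  - apply Rmult_lt_0_compat; [assumption | apply Rinv_0_lt_compat, pow2_pos].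
Qed.

(** The common index [j] is carried as a witness, which avoids a floor function. *)
Definition same_cell (m : nat) (t t' : R) : Prop :=
  exists j : nat, INR j <= t * 2 ^ m < INR j + 1 /\ INR j <= t' * 2 ^ m < INR j + 1.

Definition dyadic_step (m : nat) (g : R -> R) : Prop :=
  forall t t', same_cell m t t' -> g t = g t'.

Lemma Rsum_map_seq_double (F : nat -> R) n :
  Rsum (map F (seq 0 (2 * n))) = Rsum (map (fun j => F (2 * j)%nat + F (S (2 * j))) (seq 0 n)).
Proof.
  assert (Happ : forall l1 l2, Rsum (l1 ++ l2) = Rsum l1 + Rsum l2)
    by (induction l1; intros; simpl; [| rewrite IHl1]; ring).
  induction n as [| n IH]; [reflexivity |].
  replace (2 * S n)%nat with (S (S (2 * n))) by lia.
  rewrite !seq_S, !map_app, !Happ, IH; simpl; ring.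
Qed.

(** Raising the level by one halves each cell. Both new midpoints stay in the level [m] cell of the
    old midpoint, so [g] takes the same value there. *)
Lemma dyadic_int_refine m m' g : dyadic_step m g -> (m <= m')%nat ->
  dyadic_int m' g = dyadic_int m g.
Proof.
  intros Hg Hm; induction Hm as [| m' Hm IH]; [reflexivity |].
  rewrite <- IH; unfold dyadic_int.
  replace (2 ^ S m')%nat with (2 * 2 ^ m')%nat by (simpl; lia).
  rewrite Rsum_map_seq_double; f_equal; apply map_ext; intros j.
  assert (Hp := pow2_pos m').
  (* The level [m'] cell of index [j] lies in the level [m] cell of index [j / 2^(m' - m)]. *)
  assert (Hcell : forall c, 0 <= c < 1 ->
            g ((INR j + / 2) / 2 ^ m') = g ((INR j + c) / 2 ^ m')).
  { intros c Hc; apply Hg.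
    assert (H2 : (0 < 2 ^ (m' - m))%nat) by (apply Nat.neq_0_lt_0, Nat.pow_nonzero; lia).
    assert (Hd : 2 ^ m' = 2 ^ m * INR (2 ^ (m' - m))).
    { rewrite pow_INR; simpl (INR 2); rewrite <- pow_add; f_equal; lia. }
    assert (HN : 0 < INR (2 ^ (m' - m))) by (apply lt_0_INR; assumption).
    assert (Hj := Nat.div_mod j (2 ^ (m' - m)) ltac:(lia)).
    assert (Hr := Nat.mod_upper_bound j (2 ^ (m' - m)) ltac:(lia)).
    set (N := (2 ^ (m' - m))%nat) in *; set (d := (j / N)%nat) in *.
    set (r := (j mod N)%nat) in *.
    assert (HjR : INR j = INR N * INR d + INR r)
      by (rewrite Hj, plus_INR, mult_INR; reflexivity).
    assert (HrR : INR r + 1 <= INR N) by (rewrite <- S_INR; apply le_INR; lia).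
    assert (Hr0 := pos_INR r).
    assert (Hall : forall e, 0 <= e < 1 ->
              INR d <= (INR j + e) / 2 ^ m' * 2 ^ m < INR d + 1).
    { intros e He.
      replace ((INR j + e) / 2 ^ m' * 2 ^ m) with (INR d + (INR r + e) / INR N).
      2: { rewrite Hd, HjR; field; split; [lra | apply Rgt_not_eq, pow2_pos]. }
      assert (0 <= (INR r + e) / INR N) by (apply Rle_mult_inv_pos; lra).
      assert ((INR r + e) / INR N < 1).
      { apply (Rmult_lt_reg_r (INR N)); [assumption |].
        unfold Rdiv; rewrite Rmult_assoc, Rinv_l; lra. }
      lra. }
    exists d; split; apply Hall; lra. }
  rewrite S_INR, mult_INR; simpl (INR 2); simpl (2 ^ S m').
  (* The two halves of cell [j] have their midpoints at relative offsets 1/4 and 3/4. *)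
  replace (((1 + 1) * INR j + / 2) / (2 * 2 ^ m')) with ((INR j + / 4) / 2 ^ m') by (field; lra).
  replace (((1 + 1) * INR j + 1 + / 2) / (2 * 2 ^ m')) with ((INR j + 3 / 4) / 2 ^ m')
    by (field; lra).
  rewrite <- (Hcell (/ 4)), <- (Hcell (3 / 4)) by lra; field; lra.
Qed.

(** * Dyadic intervals as blocks of finer cells *)

Lemma in_dyadb_spec I t :
  in_dyadb I t = true <-> INR (dpos I) <= t * 2 ^ dlev I < INR (dpos I) + 1.
Proof.
  assert (Hp := pow2_pos (dlev I)).
  assert (E1 : dleft I * 2 ^ dlev I = INR (dpos I)) by (unfold dleft, dlen; field; lra).
  assert (E2 : (dleft I + dlen I) * 2 ^ dlev I = INR (dpos I) + 1)
    by (unfold dleft, dlen; field; lra).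
  rewrite <- E1 at 1; rewrite <- E2; unfold in_dyadb.
  split.
  - destruct (Rle_dec (dleft I) t); [| discriminate].
    destruct (Rlt_dec t (dleft I + dlen I)); [| discriminate].
    intros _; split; [apply Rmult_le_compat_r | apply Rmult_lt_compat_r]; lra.
  - intros [H1 H2]; apply Rmult_le_reg_r in H1; [| lra].
    apply Rmult_lt_reg_r in H2; [| lra].
    destruct (Rle_dec (dleft I) t); [| lra].
    destruct (Rlt_dec t (dleft I + dlen I)); [reflexivity | lra].
Qed.


Lemma in_dyadb_same_cell I m t t' : (dlev I <= m)%nat -> same_cell m t t' ->
  in_dyadb I t = in_dyadb I t'.
Proof.
  intros Hm [j [Ht Ht']].
  assert (Hd : 2 ^ m = 2 ^ dlev I * INR (2 ^ (m - dlev I))).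
  { rewrite pow_INR; simpl (INR 2); rewrite <- pow_add; f_equal; lia. }
  assert (H2 : (0 < 2 ^ (m - dlev I))%nat) by (apply Nat.neq_0_lt_0, Nat.pow_nonzero; lia).
  assert (HN : 0 < INR (2 ^ (m - dlev I))) by (apply lt_0_INR; assumption).
  set (N := (2 ^ (m - dlev I))%nat) in *.
  (* At level [m] the interval is a block of [N] consecutive cells, so membership depends on the
     index [j] alone. *)
  assert (Hall : forall u, INR j <= u * 2 ^ m < INR j + 1 ->
            (in_dyadb I u = true <-> (dpos I * N <= j < (dpos I + 1) * N)%nat)).
  { intros u Hu; rewrite in_dyadb_spec.
    rewrite Hd in Hu.
    replace (u * (2 ^ dlev I * INR N)) with (u * 2 ^ dlev I * INR N) in Hu by ring.
    set (z := u * 2 ^ dlev I) in *.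
    split.
    - intros [H1 H2'].
      apply (Rmult_le_compat_r (INR N)) in H1; [| lra].
      apply (Rmult_lt_compat_r (INR N)) in H2'; [| lra].
      rewrite <- S_INR in Hu, H2'; rewrite <- mult_INR in H1, H2'.
      split.
      + apply Nat.lt_succ_r, INR_lt; lra.
      + apply INR_lt; rewrite Nat.add_1_r; lra.
    - intros [H1 H2']; apply le_INR in H1.
      assert (H3 : (S j <= (dpos I + 1) * N)%nat) by lia.
      apply le_INR in H3; rewrite S_INR, mult_INR, plus_INR in H3.
      rewrite mult_INR in H1; simpl (INR 1) in H3.
      split.
      + apply (Rmult_le_reg_r (INR N)); lra.
      + apply (Rmult_lt_reg_r (INR N)); lra. }
  apply eq_iff_eq_true; rewrite (Hall t Ht), (Hall t' Ht'); reflexivity.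
Qed.

(** The contraction principle sees coefficients only through their moduli, so this lets indicators
    replace Haar functions. *)
Lemma abs_haar I t : Rabs (haar I t) = if in_dyadb I t then 1 else 0.
Proof.
  unfold haar, in_dyadb.
  assert (0 < dlen I) by (apply Rinv_0_lt_compat, pow2_pos).
  destruct (Rle_dec (dleft I) t); [| apply Rabs_R0].
  destruct (Rlt_dec t (dleft I + dlen I / 2)).
  - destruct (Rlt_dec t (dleft I + dlen I)); [apply Rabs_R1 | lra].
  - destruct (Rlt_dec t (dleft I + dlen I)); [| apply Rabs_R0].
    rewrite Rabs_left; lra.
Qed.

Lemma dlev_le_maxlev I (G : list dyad) : In I G -> (dlev I <= maxlev G)%nat.
Proof.
  unfold maxlev; induction G as [| J G IH]; simpl; [tauto |].
  intros [-> | H]; [| specialize (IH H)]; lia.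
Qed.

Lemma maxlev_incl (G G' : list dyad) : incl G G' -> (maxlev G <= maxlev G')%nat.
Proof.
  induction G as [| J G IH]; intros H; [unfold maxlev; simpl; lia |].
  assert (H1 := dlev_le_maxlev J G' (H J (or_introl eq_refl))).
  assert (H2 := IH (fun x Hx => H x (or_intror Hx))).
  unfold maxlev in *; simpl; lia.
Qed.

(** The witness is the first level [m] cell inside [I]. Hence the midpoint sums detect every
    interval of the collection, and its measure is positive. *)
Lemma exists_midpoint_in_dyad I m : (dlev I <= m)%nat ->
  exists j, (j < 2 ^ m)%nat /\ in_dyadb I ((INR j + / 2) / 2 ^ m) = true.
Proof.
  intros Hm.
  assert (Hpos := proj1 (Nat.ltb_lt _ _) (dpos_lt I)).
  assert (H2 : (0 < 2 ^ (m - dlev I))%nat) by (apply Nat.neq_0_lt_0, Nat.pow_nonzero; lia).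
  exists (dpos I * 2 ^ (m - dlev I))%nat; split.
  - replace (2 ^ m)%nat with (2 ^ dlev I * 2 ^ (m - dlev I))%nat
      by (rewrite <- Nat.pow_add_r; f_equal; lia).
    apply Nat.mul_lt_mono_pos_r; assumption.
  - apply in_dyadb_spec.
    assert (Hd : 2 ^ m = 2 ^ dlev I * INR (2 ^ (m - dlev I))).
    { rewrite pow_INR; simpl (INR 2); rewrite <- pow_add; f_equal; lia. }
    rewrite Hd, mult_INR.
    assert (HN : 1 <= INR (2 ^ (m - dlev I))) by (apply (le_INR 1); lia).
    set (N := INR (2 ^ (m - dlev I))) in *.
    replace ((INR (dpos I) * N + / 2) / (2 ^ dlev I * N) * 2 ^ dlev I)
      with (INR (dpos I) + / 2 / N) by (field; split; [lra | apply Rgt_not_eq, pow2_pos]).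
    assert (0 < / 2 / N) by (apply Rdiv_lt_0_compat; lra).
    assert (/ 2 / N <= / 2).
    { apply (Rmult_le_reg_r N); [lra |]; unfold Rdiv; rewrite Rmult_assoc, Rinv_l; lra. }
    lra.
Qed.

(** * Rademacher averages *)

Section Rademacher.
Variable X : BanachSpace.
Implicit Types (f : haar_series X) (a b : dyad -> R) (u v x y : X).

Lemma bscal_0_l x : bscal X 0 x = bzero X.
Proof. apply bnorm_eq0; rewrite bnorm_scal, Rabs_R0; ring. Qed.

Lemma bnorm_bzero : bnorm X (bzero X) = 0.
Proof. rewrite <- (bscal_0_l (bzero X)), bnorm_scal, Rabs_R0; ring. Qed.

Lemma bscal_bzero c : bscal X c (bzero X) = bzero X.
Proof. apply bnorm_eq0; rewrite bnorm_scal, bnorm_bzero; ring. Qed.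

(** Nonnegativity is not a field of [BanachSpace]; it comes from the triangle inequality for
    [x + (-1) x = 0]. *)
Lemma bnorm_nonneg x : 0 <= bnorm X x.
Proof.
  assert (H := bnorm_triangle X (bscal X 1 x) (bscal X (-1) x)).
  rewrite <- bscal_distr_r, !bnorm_scal, Rabs_R1 in H.
  replace (1 + -1) with 0 in H by ring.
  rewrite Rabs_R0, (Rabs_left (-1)) in H by lra; lra.
Qed.

Lemma badd_zero_l x : badd X (bzero X) x = x.
Proof. rewrite badd_comm; apply badd_zero_r. Qed.

Lemma badd_interchange (x y u v : X) :
  badd X (badd X x y) (badd X u v) = badd X (badd X x u) (badd X y v).
Proof.
  rewrite !badd_assoc; f_equal; rewrite <- !badd_assoc; f_equal; apply badd_comm.
Qed.

(** [signed_eval] with [haar I t] replaced by an arbitrary coefficient [a I]. All square functions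
    below become [rad_norm] of the same list [f] and differ only in [a]. *)
Definition signed_sum f a (eps : list R) : X :=
  vsum X (map (fun ex => bscal X (fst ex * a (fst (snd ex))) (snd (snd ex)))
              (combine eps f)).

Definition rad_norm f a : R :=
  sqrt (Rsum (map (fun eps => (bnorm X (signed_sum f a eps)) ^ 2)
                  (sign_lists (length f))) / 2 ^ (length f)).

Lemma rad_norm_nonneg f a : 0 <= rad_norm f a.
Proof. apply sqrt_pos. Qed.

Lemma signed_sum_plus f a b eps :
  signed_sum f (fun I => a I + b I) eps = badd X (signed_sum f a eps) (signed_sum f b eps).
Proof.
  unfold signed_sum; revert eps; induction f as [| Ix f IH]; intros [| e eps];
    simpl; try (symmetry; apply badd_zero_r).
  rewrite IH, Rmult_plus_distr_l, bscal_distr_r; apply badd_interchange.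
Qed.

Lemma signed_sum_scal f a c eps :
  signed_sum f (fun I => c * a I) eps = bscal X c (signed_sum f a eps).
Proof.
  unfold signed_sum; revert eps; induction f as [| Ix f IH]; intros [| e eps];
    simpl; try (symmetry; apply bscal_bzero).
  rewrite IH, bscal_distr_l, bscal_assoc; do 2 f_equal; ring.
Qed.

Lemma rad_norm_triangle f a b :
  rad_norm f (fun I => a I + b I) <= rad_norm f a + rad_norm f b.
Proof.
  unfold rad_norm; assert (Hp := pow2_pos (length f)).
  assert (Hs : forall c, 0 <= Rsum (map (fun eps => bnorm X (signed_sum f c eps) ^ 2)
                                        (sign_lists (length f))))
    by (intros; apply Rsum_map_nonneg; intros; apply pow2_ge_0).
  rewrite !sqrt_div_alt by assumption; unfold Rdiv; rewrite <- Rmult_plus_distr_r.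
  apply Rmult_le_compat_r; [left; apply Rinv_0_lt_compat, sqrt_lt_R0; assumption |].
  apply sqrt_sum_triangle; intros; try apply bnorm_nonneg.
  split; [apply bnorm_nonneg |]; rewrite signed_sum_plus; apply bnorm_triangle.
Qed.

Lemma rad_norm_scal f a c : 0 <= c -> rad_norm f (fun I => c * a I) = c * rad_norm f a.
Proof.
  intros Hc; transitivity (sqrt (c ^ 2) * rad_norm f a);
    [unfold rad_norm | rewrite sqrt_pow2 by assumption; reflexivity].
  rewrite <- sqrt_mult_alt by apply pow2_ge_0; f_equal.
  unfold Rdiv; rewrite <- Rmult_assoc, <- Rsum_map_scal; do 2 f_equal.
  apply map_ext; intros eps; rewrite signed_sum_scal, bnorm_scal, Rabs_pos_eq by assumption.
  ring.
Qed.

(** The mean of [|v + sum_I r_I a_I x_I|^2], averaged one sign at a time. The base vector [v]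
    collects the signs already chosen and makes induction on [f] possible. *)
Fixpoint rad_sq f a v : R :=
  match f with
  | [] => bnorm X v ^ 2
  | Ix :: f' => (rad_sq f' a (badd X v (bscal X (a (fst Ix)) (snd Ix)))
                 + rad_sq f' a (badd X v (bscal X (- a (fst Ix)) (snd Ix)))) / 2
  end.

Lemma rad_sq_eq f a v :
  Rsum (map (fun eps => (bnorm X (badd X v (signed_sum f a eps))) ^ 2)
            (sign_lists (length f))) / 2 ^ (length f) = rad_sq f a v.
Proof.
  revert v; induction f as [| [I x] f IH]; intros v.
  - simpl; rewrite badd_zero_r; field.
  - assert (Hflat : forall (F : list R -> R) l,
      Rsum (map F (flat_map (fun s => [1 :: s; -1 :: s]) l))
      = Rsum (map (fun s => F (1 :: s)) l) + Rsum (map (fun s => F (-1 :: s)) l)).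
    { intros F l; induction l as [| s l IHl]; simpl; [ring | rewrite IHl; ring]. }
    cbn [length sign_lists rad_sq fst snd]; rewrite Hflat, <- !IH.
    assert (Hsgn : forall e c, e * a I = c ->
      Rsum (map (fun s => bnorm X (badd X v (signed_sum ((I, x) :: f) a (e :: s))) ^ 2)
                (sign_lists (length f)))
      = Rsum (map (fun s => bnorm X (badd X (badd X v (bscal X c x)) (signed_sum f a s)) ^ 2)
                (sign_lists (length f)))).
    { intros e c <-; f_equal; apply map_ext; intros s; rewrite <- badd_assoc; reflexivity. }
    rewrite (Hsgn 1 (a I)), (Hsgn (-1) (- a I)) by ring.
    simpl (2 ^ S _); field; apply Rgt_not_eq, pow2_pos.
Qed.

Lemma rad_norm_eq f a : rad_norm f a = sqrt (rad_sq f a (bzero X)).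
Proof.
  rewrite <- rad_sq_eq; unfold rad_norm; do 3 f_equal.
  apply map_ext; intros eps; rewrite badd_zero_l; reflexivity.
Qed.

(** The squared norm is convex, and averaging over signs preserves convexity. *)
Lemma rad_sq_convex f a u v c : 0 <= c <= 1 ->
  rad_sq f a (badd X (bscal X c u) (bscal X (1 - c) v))
  <= c * rad_sq f a u + (1 - c) * rad_sq f a v.
Proof.
  intros Hc; revert u v; induction f as [| [I x] f IH]; intros u v; cbn [rad_sq fst snd].
  - assert (H := bnorm_triangle X (bscal X c u) (bscal X (1 - c) v)).
    rewrite !bnorm_scal, !Rabs_pos_eq in H by lra.
    assert (H0 := bnorm_nonneg (badd X (bscal X c u) (bscal X (1 - c) v))).
    assert (H2 := pow_incr _ _ 2 (conj H0 H)).
    (* This is exactly the gap between the mean of the squares and the square of the mean. *)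
    assert (0 <= c * (1 - c) * (bnorm X u - bnorm X v) ^ 2)
      by (apply Rmult_le_pos; [apply Rmult_le_pos; lra | apply pow2_ge_0]).
    lra.
  - assert (Hs : forall d, badd X (badd X (bscal X c u) (bscal X (1 - c) v)) (bscal X d x)
      = badd X (bscal X c (badd X u (bscal X d x)))
               (bscal X (1 - c) (badd X v (bscal X d x)))).
    { intros d; rewrite !bscal_distr_l, badd_interchange; f_equal.
      rewrite !bscal_assoc, <- bscal_distr_r; f_equal; ring. }
    rewrite !Hs.
    assert (H1 := IH (badd X u (bscal X (a I) x)) (badd X v (bscal X (a I) x))).
    assert (H2 := IH (badd X u (bscal X (- a I) x)) (badd X v (bscal X (- a I) x))).
    lra.
Qed.

(* [v + c x] and [v - c x] are opposite convex combinations of [v + d x] and [v - d x]. *)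
Lemma rad_sq_symmetric_le f a v x c d : Rabs c <= Rabs d ->
  rad_sq f a (badd X v (bscal X c x)) + rad_sq f a (badd X v (bscal X (- c) x))
  <= rad_sq f a (badd X v (bscal X d x)) + rad_sq f a (badd X v (bscal X (- d) x)).
Proof.
  intros H.
  destruct (Req_dec d 0) as [-> | Hd].
  { rewrite Rabs_R0 in H.
    assert (c = 0) as -> by (destruct (Req_dec c 0); [assumption |];
      assert (0 < Rabs c) by (apply Rabs_pos_lt; assumption); lra).
    lra. }
  assert (Hk : Rabs (c / d) <= 1).
  { unfold Rdiv; rewrite Rabs_mult, Rabs_inv.
    assert (0 < Rabs d) by (apply Rabs_pos_lt; assumption).
    apply (Rmult_le_reg_r (Rabs d)); [assumption |].
    rewrite Rmult_assoc, Rinv_l; lra. }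
  assert (Hk' : -1 <= c / d <= 1)
    by (unfold Rabs in Hk; destruct (Rcase_abs (c / d)); lra).
  set (k := c / d) in *; assert (Ec : c = k * d) by (unfold k; field; assumption).
  assert (Hcomb : forall s e, e = (2 * s - 1) * d ->
    badd X v (bscal X e x)
    = badd X (bscal X s (badd X v (bscal X d x)))
             (bscal X (1 - s) (badd X v (bscal X (- d) x)))).
  { intros s e ->; rewrite !bscal_distr_l, badd_interchange, !bscal_assoc.
    rewrite <- !bscal_distr_r.
    replace (s + (1 - s)) with 1 by ring; rewrite bscal_one; do 2 f_equal; ring. }
  (* The weights [(1 + k) / 2] and [(1 - k) / 2] with [k = c / d] solve [(2 s - 1) d = c] and
     [(2 s - 1) d = - c]. *)
  rewrite (Hcomb ((1 + k) / 2) c), (Hcomb ((1 - k) / 2) (- c)) by (rewrite Ec; field).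
  assert (H1 := rad_sq_convex f a (badd X v (bscal X d x)) (badd X v (bscal X (- d) x))
                  ((1 + k) / 2) ltac:(lra)).
  assert (H2 := rad_sq_convex f a (badd X v (bscal X d x)) (badd X v (bscal X (- d) x))
                  ((1 - k) / 2) ltac:(lra)).
  lra.
Qed.

(** Kahane's contraction principle: coefficients are enlarged one at a time, each by the symmetric
    comparison. The alternative [x = bzero X] serves the intervals whose stopped norm vanishes. *)
Lemma rad_sq_contraction f a b v :
  (forall I x, In (I, x) f -> x = bzero X \/ Rabs (a I) <= Rabs (b I)) ->
  rad_sq f a v <= rad_sq f b v.
Proof.
  revert v; induction f as [| [I x] f IH]; intros v H; cbn [rad_sq fst snd]; [lra |].
  assert (IH' := fun w => IH w (fun J y Hy => H J y (or_intror Hy))).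
  assert (H1 := IH' (badd X v (bscal X (a I) x))).
  assert (H2 := IH' (badd X v (bscal X (- a I) x))).
  destruct (H I x (or_introl eq_refl)) as [-> | Hab].
  - rewrite !bscal_bzero in *; lra.
  - assert (H3 := rad_sq_symmetric_le f b v x _ _ Hab); lra.
Qed.

Lemma rad_norm_contraction f a b :
  (forall I x, In (I, x) f -> x = bzero X \/ Rabs (a I) <= Rabs (b I)) ->
  rad_norm f a <= rad_norm f b.
Proof.
  intros H; rewrite !rad_norm_eq; apply sqrt_le_1_alt, rad_sq_contraction, H.
Qed.

Lemma rad_norm_zero f a : (forall I, In I (map fst f) -> a I = 0) -> rad_norm f a = 0.
Proof.
  intros H; apply Rle_antisym; [| apply rad_norm_nonneg].
  rewrite <- (Rmult_0_l (rad_norm f a)), <- rad_norm_scal by lra.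
  apply rad_norm_contraction; intros I x Hx; right.
  rewrite H, Rmult_0_l; [lra | apply (in_map fst _ _ Hx)].
Qed.

(** Jensen's inequality: by the symmetric comparison with [c = 0], deleting a random term does not
    increase the mean. *)
Lemma rad_sq_ge f a v : bnorm X v ^ 2 <= rad_sq f a v.
Proof.
  revert v; induction f as [| [I x] f IH]; intros v; cbn [rad_sq fst snd]; [lra |].
  assert (H := rad_sq_symmetric_le f a v x 0 (a I)
                 ltac:(rewrite Rabs_R0; apply Rabs_pos)).
  rewrite Ropp_0, bscal_0_l, badd_zero_r in H.
  specialize (IH v); lra.
Qed.

(** Entries before [I] are deleted without increasing the mean; the mean that remains dominates
    [|a I x|^2]. *)
Lemma rad_norm_eq0 f a I x : rad_norm f a = 0 -> In (I, x) f -> a I <> 0 -> x = bzero X.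
Proof.
  rewrite rad_norm_eq; intros H Hin Ha.
  assert (Hge : forall g v, 0 <= rad_sq g a v)
    by (intros g v; assert (H1 := rad_sq_ge g a v); assert (H2 := pow2_ge_0 (bnorm X v)); lra).
  apply sqrt_eq_0 in H; [| apply Hge].
  induction f as [| [J y] f IH]; [destruct Hin |].
  cbn [rad_sq fst snd] in H; rewrite !badd_zero_l in H.
  assert (H1 := Hge f (bscal X (a J) y)); assert (H2 := Hge f (bscal X (- a J) y)).
  destruct Hin as [E | Hin].
  - injection E as -> ->.
    assert (H3 := rad_sq_ge f a (bscal X (a I) x)).
    rewrite bnorm_scal in H3.
    apply bnorm_eq0; assert (0 < Rabs (a I)) by (apply Rabs_pos_lt; assumption).
    assert (H4 := bnorm_nonneg x).
    destruct H4 as [H4 | H4]; [| congruence].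
    assert (0 < (Rabs (a I) * bnorm X x) ^ 2)
      by (apply pow_lt, Rmult_lt_0_compat; assumption).
    lra.
  - apply IH; [| assumption].
    assert (H3 := rad_sq_symmetric_le f a (bzero X) y 0 (a J)
                    ltac:(rewrite Rabs_R0; apply Rabs_pos)).
    rewrite Ropp_0, bscal_0_l, !badd_zero_l in H3.
    specialize (Hge f (bzero X)); lra.
Qed.

Lemma Sfun_rad_norm f t :
  Sfun X f t = rad_norm f (fun I => if in_dyadb I t then 1 else 0).
Proof.
  change (Sfun X f t) with (rad_norm f (fun I => haar I t)).
  apply Rle_antisym; apply rad_norm_contraction; intros I x _; right;
    rewrite abs_haar; destruct (in_dyadb I t); rewrite ?Rabs_R0, ?Rabs_R1; lra.
Qed.

(** Used with [k] the identity for the reweighted series and [k = tau] for rearranged ones, so that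
    both are compared over the original list. *)
Lemma Sfun_map_rad_norm f (k : dyad -> dyad) (c : dyad -> R) t :
  Sfun X (map (fun Ix => (k (fst Ix), bscal X (c (fst Ix)) (snd Ix))) f) t
  = rad_norm f (fun I => haar (k I) t * c I).
Proof.
  unfold Sfun, rad_norm; rewrite length_map; do 3 f_equal.
  apply map_ext; intros eps; do 2 f_equal.
  unfold signed_eval, signed_sum; f_equal.
  revert eps; induction f as [| Ix f IH]; intros [| e eps]; simpl; try reflexivity.
  rewrite IH, bscal_assoc, Rmult_assoc; reflexivity.
Qed.
End Rademacher.

(** * Stopped square functions *)

Section Stopping.
Variable X : BanachSpace.
Variable f : haar_series X.

(* The constant value on [I] of the square function of the part of [f]
   supported on the dyadic intervals containing [I]. *)
Definition stopped_norm (I : dyad) : R :=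
  rad_norm X f (fun J => if (dlev J <=? dlev I)%nat && in_dyadb J (dleft I) then 1 else 0).

(** An interval [J] no shorter than [I] contains all of [I] or none of it, so the left endpoint may
    stand for any point of [I]. *)
Lemma in_dyadb_dleft I J t : in_dyadb I t = true -> (dlev J <= dlev I)%nat ->
  in_dyadb J (dleft I) = in_dyadb J t.
Proof.
  intros Ht HJ; apply (in_dyadb_same_cell J (dlev I)); [assumption |].
  exists (dpos I); split; [| apply in_dyadb_spec; assumption].
  replace (dleft I * 2 ^ dlev I) with (INR (dpos I)); [lra |].
  unfold dleft, dlen; field; apply Rgt_not_eq, pow2_pos.
Qed.

Lemma stopped_norm_le_Sfun I t : in_dyadb I t = true -> stopped_norm I <= Sfun X f t.
Proof.
  intros Ht; rewrite Sfun_rad_norm; apply rad_norm_contraction; intros J x _; right.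
  destruct (Nat.leb_spec (dlev J) (dlev I)) as [HJ | HJ]; simpl.
  - rewrite (in_dyadb_dleft I J t Ht HJ); lra.
  - rewrite Rabs_R0; apply Rabs_pos.
Qed.

(** The interval [I] itself enters its stopped sum with coefficient 1. *)
Lemma stopped_norm_eq0 I x : In (I, x) f -> stopped_norm I = 0 -> x = bzero X.
Proof.
  intros Hin H; apply (rad_norm_eq0 X f _ I x H Hin).
  rewrite Nat.leb_refl; simpl.
  replace (in_dyadb I (dleft I)) with true; [lra |].
  symmetry; apply in_dyadb_spec.
  replace (dleft I * 2 ^ dlev I) with (INR (dpos I)); [lra |].
  unfold dleft, dlen; field; apply Rgt_not_eq, pow2_pos.
Qed.

(** [phi = 1] gives one layer of the Abel summation, [phi s = s^(a - 1) - c] the remainder.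
    Positivity of the stopped norm keeps [Rpower] away from its default value at base 0. *)
Definition low_weight (t m : R) (phi : R -> R) (J : dyad) : R :=
  if in_dyadb J t then
    if Rlt_dec 0 (stopped_norm J) then
      if Rle_dec (stopped_norm J) m then phi (stopped_norm J) else 0
    else 0
  else 0.

(* The intervals selected form a chain; its smallest element bounds the sum. *)
Lemma rad_norm_low_weight t m : 0 <= m -> rad_norm X f (low_weight t m (fun _ => 1)) <= m.
Proof.
  intros Hm.
  set (P := fun J => if in_dyadb J t then if Rle_dec (stopped_norm J) m then true else false
                     else false).
  set (G := filter P (map fst f)).
  assert (HG : forall J, In J (map fst f) -> low_weight t m (fun _ => 1) J <> 0 -> In J G).
  { intros J HJ H; apply filter_In; split; [assumption |].
    unfold low_weight in H; unfold P.
    destruct (in_dyadb J t); [| tauto].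
    destruct (Rlt_dec 0 (stopped_norm J)); [| tauto].
    destruct (Rle_dec (stopped_norm J) m); tauto. }
  assert (E : G = [] \/ G <> []) by (destruct G; [left; reflexivity | right; discriminate]).
  destruct E as [E | E].
  - rewrite rad_norm_zero; [assumption |].
    intros J HJ; destruct (Req_dec (low_weight t m (fun _ => 1) J) 0) as [| H]; [assumption |].
    specialize (HG J HJ H); rewrite E in HG; destruct HG.
  - destruct (exists_argmax _ G (fun J => INR (dlev J)) E) as [I [HI Hmax]].
    apply filter_In in HI; destruct HI as [_ HI]; unfold P in HI.
    destruct (in_dyadb I t) eqn:Et; [| discriminate].
    destruct (Rle_dec (stopped_norm I) m) as [Hle |]; [| discriminate].
    apply Rle_trans with (stopped_norm I); [| assumption].
    apply rad_norm_contraction; intros J x Hx; right.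
    apply (in_map fst) in Hx; simpl in Hx.
    destruct (Req_dec (low_weight t m (fun _ => 1) J) 0) as [-> | H].
    { rewrite Rabs_R0; apply Rabs_pos. }
    assert (HJ : (dlev J <= dlev I)%nat) by (apply INR_le, Hmax, HG; assumption).
    rewrite (proj2 (Nat.leb_le _ _) HJ), (in_dyadb_dleft I J t Et HJ); simpl.
    unfold low_weight; destruct (in_dyadb J t); [| rewrite Rabs_R0; lra].
    destruct (Rlt_dec 0 (stopped_norm J)); [| rewrite Rabs_R0; apply Rabs_pos].
    destruct (Rle_dec (stopped_norm J) m); [lra | rewrite Rabs_R0; apply Rabs_pos].
Qed.

Lemma rad_norm_ext a b : (forall J, In J (map fst f) -> a J = b J) ->
  rad_norm X f a <= rad_norm X f b.
Proof.
  intros H; apply rad_norm_contraction; intros J x Hx; right.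
  rewrite H; [lra | apply (in_map fst _ _ Hx)].
Qed.

(* Abel summation along the levels of [stopped_norm] below [m]. *)
Lemma rad_norm_low_weight_power t a : 0 < a <= 1 -> forall n m c,
  0 < m -> c <= Rpower m (a - 1) ->
  (length (filter (fun J => if in_dyadb J t then
             if Rlt_dec 0 (stopped_norm J) then
               if Rlt_dec (stopped_norm J) m then true else false
             else false else false) (map fst f)) <= n)%nat ->
  rad_norm X f (low_weight t m (fun s => Rpower s (a - 1) - c)) <= Rpower m a / a - c * m.
Proof.
  intros Ha n; induction n as [n IH] using lt_wf_ind; intros m c Hm Hc Hn.
  set (P := fun m J => if in_dyadb J t then
             if Rlt_dec 0 (stopped_norm J) then
               if Rlt_dec (stopped_norm J) m then true else false
             else false else false) in *.
  change (length (filter (P m) (map fst f)) <= n)%nat in Hn.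
  assert (HP : forall m' J, P m' J = true <->
            in_dyadb J t = true /\ 0 < stopped_norm J /\ stopped_norm J < m').
  { intros m' J; unfold P; destruct (in_dyadb J t); [| intuition discriminate].
    destruct (Rlt_dec 0 (stopped_norm J)); [| intuition discriminate].
    destruct (Rlt_dec (stopped_norm J) m'); intuition discriminate. }
  (* The top layer, of constant weight [m^(a - 1) - c], costs at most [(m^(a - 1) - c) m]. *)
  assert (Hlow := rad_norm_low_weight t m ltac:(lra)).
  apply (Rmult_le_compat_l (Rpower m (a - 1) - c)) in Hlow; [| lra].
  rewrite <- rad_norm_scal in Hlow by lra.
  assert (Hma : Rpower m a = Rpower m (a - 1) * m).
  { rewrite <- (Rpower_1 m) at 3 by assumption; rewrite <- Rpower_plus; f_equal; ring. }
  assert (Hpm := Rpower_pos m a).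
  destruct (filter (P m) (map fst f)) as [| I0 G0] eqn:EG.
  (* With no positive stopped norm strictly below [m], only the value [m] is selected and the top
     layer is the whole sum. *)
  - eapply Rle_trans; [| eapply Rle_trans; [apply Hlow |]].
    + apply rad_norm_ext; intros J HJ.
      unfold low_weight; destruct (in_dyadb J t) eqn:Et; [| ring].
      destruct (Rlt_dec 0 (stopped_norm J)) as [H0 |]; [| ring].
      destruct (Rle_dec (stopped_norm J) m) as [Hle |]; [| ring].
      destruct Hle as [Hlt | ->]; [| ring].
      exfalso; assert (Hin : In J (filter (P m) (map fst f)))
        by (apply filter_In; split; [assumption | apply HP; auto]).
      rewrite EG in Hin; destruct Hin.
    + rewrite Rmult_minus_distr_r, <- Hma.
      assert (Rpower m a <= Rpower m a / a); [| lra].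
      apply (Rmult_le_reg_r a); [lra |].
      unfold Rdiv; rewrite Rmult_assoc, Rinv_l; nra.
  (* Let [m'] be the largest value below [m]. In [s^(a - 1) - c = (m^(a - 1) - c) + (s^(a - 1) -
     m^(a - 1))] the last bracket vanishes at [s = m], so it lives on [s <= m'], where the induction
     applies with [c] replaced by [m^(a - 1)]. *)
  - destruct (exists_argmax _ (I0 :: G0) stopped_norm) as [I [HI Hmax]]; [discriminate |].
    rewrite <- EG in HI, Hmax, Hn.
    apply filter_In in HI; destruct HI as [HI1 HI2].
    assert (HI3 := proj1 (HP m I) HI2); destruct HI3 as [It [I0' Im]].
    set (m' := stopped_norm I) in *.
    assert (Hlen : (length (filter (P m') (map fst f)) < length (filter (P m) (map fst f)))%nat).
    { apply filter_length_lt with I; [| assumption | | assumption].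
      - intros J HJ; apply HP in HJ; apply HP; destruct HJ as [? []]; repeat split; lra || auto.
      - destruct (P m' I) eqn:E; [| reflexivity].
        apply HP in E; destruct E as [_ [_ E]]; unfold m' in E; lra. }
    assert (Hrec := IH (length (filter (P m') (map fst f))) ltac:(lia) m' (Rpower m (a - 1))
                      I0' (Rpower_anti m' m a ltac:(lra) ltac:(lra)) (le_n _)).
    (* The two bounds add up to at most [m^a / a - c m] because
       [m^(a - 1) (m - m') <= m^a / a - m'^a / a]. *)
    assert (Htan := Rpower_tangent m' m a I0' Hm Ha).
    assert (Htri := rad_norm_triangle X f
      (fun J => (Rpower m (a - 1) - c) * low_weight t m (fun _ => 1) J)
      (low_weight t m' (fun s => Rpower s (a - 1) - Rpower m (a - 1)))).
    eapply Rle_trans; [| eapply Rle_trans; [apply Htri | lra]].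
    apply rad_norm_ext; intros J HJ.
    unfold low_weight; destruct (in_dyadb J t) eqn:Et; [| ring].
    destruct (Rlt_dec 0 (stopped_norm J)) as [H0 |]; [| ring].
    destruct (Rle_dec (stopped_norm J) m) as [Hle | Hnle];
      destruct (Rle_dec (stopped_norm J) m') as [Hle' | Hnle']; try ring; try lra.
    destruct Hle as [Hlt | ->]; [| ring].
    exfalso; apply Hnle', Hmax, filter_In; split; [assumption | apply HP; auto].
Qed.

(** The derivative of [s^a] at the stopped norm. Where the stopped norm is 0 the coefficient of [f]
    is 0 as well. *)
Definition stopped_weight (a : R) (I : dyad) : R :=
  if Rlt_dec 0 (stopped_norm I) then a * Rpower (stopped_norm I) (a - 1) else 0.

Lemma rad_norm_stopped_weight a t : 0 < a <= 1 ->
  rad_norm X f (fun I => haar I t * stopped_weight a I) <= rpow (Sfun X f t) a.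
Proof.
  intros Ha.
  destruct (rad_norm_nonneg X f (fun I => haar I t)) as [Hpos | Hz];
    [change (0 < Sfun X f t) in Hpos | change (0 = Sfun X f t) in Hz].
  - rewrite rpow_pos_eq by assumption.
    (* The choice [m = S(f)(t)], [c = 0] selects every interval through [t] of positive stopped
       norm, since stopped norms there are at most [S(f)(t)]. *)
    assert (H := rad_norm_low_weight_power t a Ha _ (Sfun X f t) 0 Hpos
                   ltac:(left; apply Rpower_pos) (le_n _)).
    apply (Rmult_le_compat_l a) in H; [| lra].
    rewrite <- rad_norm_scal in H by lra.
    replace (a * (Rpower (Sfun X f t) a / a - 0 * Sfun X f t)) with (Rpower (Sfun X f t) a)
      in H by (field; lra).
    eapply Rle_trans; [| apply H].
    apply rad_norm_contraction; intros I x _; right.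
    rewrite Rabs_mult, abs_haar; unfold low_weight.
    destruct (in_dyadb I t) eqn:Et; [| rewrite Rmult_0_l; apply Rabs_pos].
    unfold stopped_weight; destruct (Rlt_dec 0 (stopped_norm I)) as [H0 | H0].
    + destruct (Rle_dec (stopped_norm I) (Sfun X f t)) as [_ | Hn].
      * rewrite Rmult_1_l, Rminus_0_r; lra.
      * destruct Hn; apply stopped_norm_le_Sfun; assumption.
    + rewrite Rabs_R0, Rmult_0_r; apply Rabs_pos.
  - rewrite rad_norm_zero; [apply rpow_nonneg |].
    intros I _; destruct (in_dyadb I t) eqn:Et.
    + assert (H := stopped_norm_le_Sfun I t Et).
      unfold stopped_weight; destruct (Rlt_dec 0 (stopped_norm I)); [lra | ring].
    + assert (H := abs_haar I t); rewrite Et in H.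
      destruct (Req_dec (haar I t) 0) as [-> | Hh]; [ring |].
      apply Rabs_no_R0 in Hh; tauto.
Qed.
End Stopping.

(** * The Carleson-type constant *)

Lemma dlen_pos I : 0 < dlen I.
Proof. apply Rinv_0_lt_compat, pow2_pos. Qed.

Lemma dlen_ratio_pos I J : 0 < dlen I / dlen J.
Proof. apply Rdiv_lt_0_compat; apply dlen_pos. Qed.

Lemma maxmap_indicator_step (G : list dyad) (k : dyad -> dyad) (c : dyad -> R) m :
  (maxlev (map k G) <= m)%nat ->
  dyadic_step m (fun t => maxmap _ G (fun I => if in_dyadb (k I) t then c I else 0)).
Proof.
  intros Hm t t' Ht; unfold maxmap; f_equal; apply map_ext_in; intros I HI.
  rewrite (in_dyadb_same_cell (k I) m t t'); [reflexivity | | assumption].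
  eapply Nat.le_trans; [apply dlev_le_maxlev, in_map, HI | assumption].
Qed.

Definition indicator_union (G : list dyad) (t : R) : R :=
  if existsb (fun I => in_dyadb I t) G then 1 else 0.

Lemma indicator_union_maxmap G t :
  indicator_union G t = maxmap _ G (fun I => if in_dyadb I t then 1 else 0).
Proof.
  unfold indicator_union; destruct (existsb (fun I => in_dyadb I t) G) eqn:E.
  - apply existsb_exists in E; destruct E as [I [HI Ht]].
    apply Rle_antisym.
    + eapply Rle_trans; [| apply (le_maxmap _ G _ I HI)]; simpl; rewrite Ht; lra.
    + apply maxmap_le; [lra |]; intros J _; destruct (in_dyadb J t); lra.
  - apply Rle_antisym; [apply maxmap_nonneg |].
    apply maxmap_le; [lra |]; intros J HJ.
    destruct (in_dyadb J t) eqn:Et; [| lra].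
    assert (existsb (fun I => in_dyadb I t) G = true) by (apply existsb_exists; eauto).
    congruence.
Qed.

Lemma union_meas_pos G : G <> [] -> 0 < union_meas G.
Proof.
  destruct G as [| I G]; intros H; [tauto |].
  destruct (exists_midpoint_in_dyad I (maxlev (I :: G))) as [j [Hj Ht]];
    [apply dlev_le_maxlev; simpl; auto |].
  apply dyadic_int_pos with j; [| assumption |].
  - intros t; destruct (existsb _ _); lra.
  - cbn [existsb]; rewrite Ht; simpl; lra.
Qed.

(** The collection consisting of [0,1) alone has a positive quotient. Positivity of [M] permits
    dividing by it in Young's inequality. *)
Lemma C1_bound_pos tau M : C1_bound tau M -> 0 < M.
Proof.
  intros H.
  set (I := mkDyad 0 0 eq_refl).
  eapply Rlt_le_trans; [| apply (H [I])]; [| discriminate].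
  apply Rdiv_lt_0_compat; [| apply union_meas_pos; discriminate].
  destruct (exists_midpoint_in_dyad (tau I) (maxlev (map tau [I]))) as [j [Hj Ht]];
    [apply dlev_le_maxlev; simpl; auto |].
  apply dyadic_int_pos with j; [intros t; apply maxmap_nonneg | assumption |].
  eapply Rlt_le_trans; [| apply (le_maxmap _ _ _ I); simpl; auto].
  cbv beta; rewrite Ht; apply dlen_ratio_pos.
Qed.

(** The defining quotient cleared of its denominator and moved to any sufficiently fine levels; for
    empty [G] both sides are 0. *)
Lemma C1_bound_mul tau M G m0 m1 : C1_bound tau M ->
  (maxlev G <= m0)%nat -> (maxlev (map tau G) <= m1)%nat ->
  dyadic_int m1 (mu tau G) <= M * dyadic_int m0 (indicator_union G).
Proof.
  intros H H0 H1.
  rewrite (dyadic_int_refine (maxlev (map tau G)) m1 (mu tau G));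
    [| apply maxmap_indicator_step; lia | assumption].
  rewrite (dyadic_int_refine (maxlev G) m0); [| | assumption].
  2: { intros t t' Ht; rewrite !indicator_union_maxmap.
       apply (maxmap_indicator_step G (fun I => I) (fun _ => 1) (maxlev G));
         [rewrite map_id; lia | assumption]. }
  change (dyadic_int (maxlev G) (indicator_union G)) with (union_meas G).
  destruct G as [| I G].
  - apply Req_le; unfold union_meas, dyadic_int, mu; simpl; field.
  - assert (HG : I :: G <> []) by discriminate.
    assert (Hu := union_meas_pos _ HG); specialize (H _ HG).
    apply (Rmult_le_compat_r (union_meas (I :: G))) in H; [| lra].
    unfold Rdiv in H; rewrite Rmult_assoc, Rinv_l, Rmult_1_r in H by lra; assumption.
Qed.

(* Layer-cake form of the constant [C_1]: peel off the smallest value of [s] on [G]. *)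
Lemma C1_bound_layer_cake tau M : C1_bound tau M -> forall n G (s : dyad -> R) m0 m1,
  (length G <= n)%nat -> (forall I, In I G -> 0 <= s I) ->
  (maxlev G <= m0)%nat -> (maxlev (map tau G) <= m1)%nat ->
  dyadic_int m1 (fun t => maxmap _ G
    (fun I => if in_dyadb (tau I) t then s I * (dlen I / dlen (tau I)) else 0))
  <= M * dyadic_int m0 (fun t => maxmap _ G (fun I => if in_dyadb I t then s I else 0)).
Proof.
  intros HC n; assert (HM := C1_bound_pos _ _ HC).
  induction n as [n IH] using lt_wf_ind; intros G s m0 m1 Hn Hs H0 H1.
  destruct G as [| J0 G0] eqn:EG.
  { unfold maxmap; simpl.
    assert (E := dyadic_int_lincomb m1 0 0 (fun _ => 0) (fun _ => 0)).
    assert (E' := dyadic_int_nonneg m0 (fun _ => 0) ltac:(intros; lra)).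
    rewrite !Rmult_0_l, Rplus_0_r in E; rewrite E.
    apply Rmult_le_pos; lra. }
  rewrite <- EG in *; assert (HG : G <> []) by (rewrite EG; discriminate).
  clear J0 G0 EG.
  (* A maximiser of [- s] minimises [s]; [G'] then discards every interval on which the minimum [c]
     is taken. *)
  destruct (exists_argmax _ G (fun I => - s I) HG) as [I0 [HI0 Hmin]].
  cbv beta in Hmin.
  set (c := s I0) in *.
  assert (Hc : 0 <= c) by (apply Hs; assumption).
  assert (Hmin' : forall I, In I G -> c <= s I)
    by (intros I HI; specialize (Hmin I HI); lra).
  set (P := fun I => if Rlt_dec c (s I) then true else false).
  set (G' := filter P G).
  assert (Hincl : incl G' G) by (intros I HI; apply filter_In in HI; tauto).
  assert (Hlen : (length G' < length G)%nat).
  { assert (Hlt := filter_length_lt _ G P (fun _ => true) I0 ltac:(auto) HI0).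
    replace (filter (fun _ => true) G) with G in Hlt.
    - apply Hlt; [unfold P, c; destruct (Rlt_dec (s I0) (s I0)); [lra | reflexivity] | reflexivity].
    - clear; induction G as [| I G IHG]; simpl; congruence. }
  assert (Hrec := IH (length G') ltac:(lia) G' (fun I => s I - c) m0 m1 (le_n _)
    ltac:(intros I HI; specialize (Hmin' I (Hincl I HI)); lra)
    ltac:(eapply Nat.le_trans; [apply maxlev_incl, Hincl | assumption])
    ltac:(eapply Nat.le_trans; [apply maxlev_incl, incl_map, Hincl | assumption])).
  assert (HC1 := C1_bound_mul tau M G m0 m1 HC H0 H1).
  eapply Rle_trans; [| eapply Rle_trans; [| apply Rmult_le_compat_l; [lra |]]].
  (* On the target side, writing [s = c + (s - c)] bounds the maximum by the sum of the two
     maxima. *)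
  - apply (dyadic_int_le m1 _ (fun t => c * mu tau G t + 1 * maxmap _ G'
      (fun I => if in_dyadb (tau I) t then (s I - c) * (dlen I / dlen (tau I)) else 0))).
    intros t.
    set (F := fun I => if in_dyadb (tau I) t then (s I - c) * (dlen I / dlen (tau I)) else 0).
    assert (Hmu := maxmap_nonneg _ G
      (fun I => if in_dyadb (tau I) t then dlen I / dlen (tau I) else 0)).
    change (0 <= mu tau G t) in Hmu.
    assert (HF := maxmap_nonneg _ G' F).
    apply maxmap_le; [assert (0 <= c * mu tau G t) by (apply Rmult_le_pos; assumption); lra |].
    intros I HI.
    assert (HmuI := le_maxmap _ G
      (fun I => if in_dyadb (tau I) t then dlen I / dlen (tau I) else 0) I HI).
    change (maxmap _ G _) with (mu tau G t) in HmuI; cbv beta in HmuI.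
    destruct (in_dyadb (tau I) t) eqn:Et.
    + apply (Rmult_le_compat_l c) in HmuI; [| assumption].
      destruct (Rle_lt_dec (s I) c) as [Hle | Hlt].
      * assert (s I * (dlen I / dlen (tau I)) <= c * (dlen I / dlen (tau I)))
          by (apply Rmult_le_compat_r; [left; apply dlen_ratio_pos | assumption]).
        lra.
      * assert (HI' : In I G').
        { apply filter_In; split; [assumption |]; unfold P.
          destruct (Rlt_dec c (s I)); [reflexivity | lra]. }
        assert (HFI := le_maxmap _ G' F I HI'); unfold F at 1 in HFI; rewrite Et in HFI; lra.
    + assert (0 <= c * mu tau G t) by (apply Rmult_le_pos; assumption); lra.
  - rewrite dyadic_int_lincomb.
    apply (Rmult_le_compat_l c) in HC1; [| assumption].
    eapply Rle_trans; [apply Rplus_le_compat; [apply HC1 | rewrite Rmult_1_l; apply Hrec] |].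
    match goal with |- c * (M * ?u) + M * ?v <= _ =>
      replace (c * (M * u) + M * v) with (M * (c * u + 1 * v)) by ring end.
    rewrite <- dyadic_int_lincomb; apply Rle_refl.
  (* On the source side the reverse bound holds: the first layer equals [c] on the whole union, so
     adding it to the maximum of [s - c] gives a value [s I] with [t] in [I], or [c], which is at
     most such a value. *)
  - apply dyadic_int_le; intros t; cbv beta.
    set (F := fun I => if in_dyadb I t then s I - c else 0).
    set (F' := fun I => if in_dyadb I t then s I else 0).
    destruct (maxmap_attained _ G' F) as [-> | [I [HI ->]]].
    + unfold indicator_union; destruct (existsb (fun I => in_dyadb I t) G) eqn:E.
      * apply existsb_exists in E; destruct E as [I [HI Ht]].
        assert (HFI := le_maxmap _ G F' I HI); unfold F' at 1 in HFI; rewrite Ht in HFI.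
        specialize (Hmin' I HI); lra.
      * assert (HF := maxmap_nonneg _ G F'); lra.
    + apply Hincl in HI.
      assert (HFI := le_maxmap _ G F' I HI); unfold F' at 1 in HFI; unfold F.
      unfold indicator_union; destruct (existsb (fun I => in_dyadb I t) G) eqn:E.
      * destruct (in_dyadb I t) eqn:Et; [lra |].
        apply existsb_exists in E; destruct E as [J [HJ Ht]].
        assert (HFJ := le_maxmap _ G F' J HJ); unfold F' at 1 in HFJ; rewrite Ht in HFJ.
        specialize (Hmin' J HJ); lra.
      * destruct (in_dyadb I t) eqn:Et; [| lra].
        assert (existsb (fun I => in_dyadb I t) G = true) by (apply existsb_exists; eauto).
        congruence.
Qed.

(** * Extrapolation *)

(** Pointwise substitute for Hölder's inequality: Young's inequality for [n / M] and [b^p / L^p]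
    with weights [1 - q / p] and [q / p]. If [n] has integral at most [M] and [b^p] at most [L^p],
    the second factor has integral at most 1. *)
Lemma rpow_young (q p x n b M L : R) : 0 < q -> q <= p -> 0 <= n -> 0 <= b -> 0 < M -> 0 < L ->
  x <= p / q * (rpow n (/ q - / p) * b) ->
  rpow x q <= rpow (p / q * Rpower M (/ q - / p) * L) q
              * ((1 - q / p) / M * n + (q / p) / rpow L p * rpow b p).
Proof.
  intros Hq Hqp Hn Hb HM HL Hx.
  assert (Ha : 0 < q / p <= 1).
  { split; [apply Rdiv_lt_0_compat; lra |].
    apply (Rmult_le_reg_r p); [lra |]; unfold Rdiv; rewrite Rmult_assoc, Rinv_l; lra. }
  assert (Hpq : 0 < p / q) by (apply Rdiv_lt_0_compat; lra).
  assert (HLp : 0 < rpow L p) by (rewrite rpow_pos_eq by assumption; apply Rpower_pos).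
  assert (Hrhs : 0 <= (1 - q / p) / M * n + (q / p) / rpow L p * rpow b p).
  { apply Rplus_le_le_0_compat; apply Rmult_le_pos; try assumption; try apply rpow_nonneg;
      apply Rle_mult_inv_pos; lra. }
  assert (Hx0 : x <= 0 -> rpow x q <= rpow (p / q * Rpower M (/ q - / p) * L) q
              * ((1 - q / p) / M * n + (q / p) / rpow L p * rpow b p)).
  { intros H; rewrite (rpow_nonpos_eq x) by assumption.
    apply Rmult_le_pos; [apply rpow_nonneg | assumption]. }
  destruct Hn as [Hn | <-]; [| apply Hx0; rewrite rpow_nonpos_eq in Hx by lra; lra].
  destruct Hb as [Hb | <-]; [| apply Hx0; lra].
  assert (HY := weighted_AMGM (n / M) (Rpower b p / Rpower L p) (q / p)
    ltac:(apply Rdiv_lt_0_compat; assumption)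
    ltac:(apply Rdiv_lt_0_compat; apply Rpower_pos) ltac:(lra)).
  rewrite !(rpow_pos_eq L), !(rpow_pos_eq b) in * by assumption.
  rewrite (rpow_pos_eq n) in Hx by assumption.
  apply (rpow_le _ _ q) in Hx; [| lra].
  eapply Rle_trans; [apply Hx |].
  assert (HK : 0 < p / q * Rpower M (/ q - / p) * L)
    by (apply Rmult_lt_0_compat; [apply Rmult_lt_0_compat; [lra | apply Rpower_pos] | lra]).
  (* The power [M^(1 - q / p)] coming from the constant cancels that of [n / M], and [L^q] cancels
     likewise, so this step is an equality. *)
  apply Rle_trans with (rpow (p / q * Rpower M (/ q - / p) * L) q
    * (Rpower (n / M) (1 - q / p) * Rpower (Rpower b p / Rpower L p) (q / p))).
  - apply Req_le.
    assert (HR := Rpower_pos).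
    assert (Hd : forall y z c, 0 < y -> 0 < z -> Rpower (y / z) c = Rpower y c * Rpower z (- c)).
    { intros y z c Hy Hz; unfold Rdiv.
      rewrite <- Rpower_mult_distr by (try apply Rinv_0_lt_compat; assumption).
      f_equal; rewrite <- (Rpower_1 z) at 1 by assumption.
      rewrite <- Rpower_Ropp, Rpower_mult; f_equal; ring. }
    rewrite (rpow_pos_eq _ q HK), rpow_pos_eq
      by (apply Rmult_lt_0_compat; [assumption | apply Rmult_lt_0_compat; auto]).
    rewrite (Hd n M), (Hd (Rpower b p) (Rpower L p)) by auto.
    rewrite <- !Rpower_mult_distr by (first [assumption | apply HR | apply Rmult_lt_0_compat; auto]).
    rewrite !Rpower_mult.
    replace ((/ q - / p) * q) with (1 - q / p) by (field; lra).
    replace (p * (q / p)) with q by (field; lra).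
    replace (p * - (q / p)) with (- q) by (field; lra).
    rewrite !Rpower_Ropp; field; split; apply Rgt_not_eq, HR.
  - apply Rmult_le_compat_l; [apply rpow_nonneg |].
    eapply Rle_trans; [apply HY |]; apply Req_le; field; repeat split; lra.
Qed.

Section Extrapolation.
Variables (X : BanachSpace) (tau : dyad -> dyad) (q p : R).
Hypotheses (Hq : 0 < q) (Hqp : q <= p).
Variable f : haar_series X.

(** The auxiliary series [g] with [a = q / p]. *)
Definition reweighted : haar_series X :=
  map (fun Ix => (fst Ix, bscal X (stopped_weight X f (q / p) (fst Ix)) (snd Ix))) f.

Lemma reweighted_support : map fst reweighted = map fst f.
Proof. unfold reweighted; rewrite map_map; reflexivity. Qed.

Lemma rearr_support (r : R) (g : haar_series X) : map fst (rearr X tau r g) = map tau (map fst g).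
Proof. unfold rearr; rewrite !map_map; reflexivity. Qed.

Let Hratio : 0 < q / p <= 1.
Proof.
  split; [apply Rdiv_lt_0_compat; lra |].
  apply (Rmult_le_reg_r p); [lra |]; unfold Rdiv; rewrite Rmult_assoc, Rinv_l; lra.
Qed.

Lemma Hnorm_le_iff (r : R) (g : haar_series X) (L : R) : 0 < r -> 0 <= L ->
  (Hnorm X r g <= L <->
   dyadic_int (S (maxlev (map fst g))) (fun t => rpow (Sfun X g t) r) <= rpow L r).
Proof.
  intros Hr HL; unfold Hnorm; split; intros H.
  - apply rpow_inv_le; try assumption; apply dyadic_int_nonneg; intros; apply rpow_nonneg.
  - apply rpow_inv_le_of_le; assumption.
Qed.

(** Pointwise [S(g)^p <= S(f)^(a p) = S(f)^q]. *)
Lemma Hnorm_reweighted : Hnorm X q f <= 1 -> Hnorm X p reweighted <= 1.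
Proof.
  rewrite !Hnorm_le_iff, !rpow_one_l, reweighted_support by lra.
  intros H; eapply Rle_trans; [apply dyadic_int_le | apply H].
  intros t; cbv beta.
  replace (rpow (Sfun X f t) q) with (rpow (rpow (Sfun X f t) (q / p)) p)
    by (rewrite rpow_rpow; f_equal; field; lra).
  apply rpow_le; [lra |].
  unfold reweighted.
  rewrite (Sfun_map_rad_norm X f (fun I => I) (stopped_weight X f (q / p))).
  apply rad_norm_stopped_weight; assumption.
Qed.

(** The function [N]: a version of [mu] weighted by the q-th powers of the stopped norms. *)
Definition stopped_mu (t : R) : R :=
  maxmap _ (map fst f) (fun I => if in_dyadb (tau I) t
    then rpow (stopped_norm X f I) q * (dlen I / dlen (tau I)) else 0).

(** Contraction, coefficient by coefficient. With [s] the stopped norm and [r = |I| / |tau I|], the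
    identity [r^(1/q) = (s^q r)^(1/q - 1/p) r^(1/p) s^(q/p - 1)] holds, and [s^q r <= N] on [tau I].
    The factor [p / q] undoes the [a] in [stopped_weight]. *)
Lemma Sfun_rearr_le t :
  Sfun X (rearr X tau q f) t
  <= p / q * (rpow (stopped_mu t) (/ q - / p) * Sfun X (rearr X tau p reweighted) t).
Proof.
  assert (Hexp : 0 <= / q - / p)
    by (assert (/ p <= / q) by (apply Rinv_le_contravar; lra); lra).
  assert (Hpq : 0 < p / q) by (apply Rdiv_lt_0_compat; lra).
  unfold rearr at 1.
  rewrite (Sfun_map_rad_norm X f tau (fun I => rpow (dlen I / dlen (tau I)) (/ q))).
  assert (E : rearr X tau p reweighted = map (fun Ix => (tau (fst Ix), bscal X
    (rpow (dlen (fst Ix) / dlen (tau (fst Ix))) (/ p) * stopped_weight X f (q / p) (fst Ix))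
    (snd Ix))) f).
  { unfold rearr, reweighted; rewrite map_map; apply map_ext; intros Ix; simpl.
    rewrite bscal_assoc; reflexivity. }
  rewrite E, (Sfun_map_rad_norm X f tau (fun I => rpow (dlen I / dlen (tau I)) (/ p)
                                           * stopped_weight X f (q / p) I)).
  rewrite <- Rmult_assoc, <- rad_norm_scal
    by (apply Rmult_le_pos; [lra | apply rpow_nonneg]).
  apply rad_norm_contraction; intros I x Hx.
  destruct (Rlt_dec 0 (stopped_norm X f I)) as [Hs | Hs].
  2: { left; apply (stopped_norm_eq0 X f I); [assumption |].
       assert (H := rad_norm_nonneg X f (fun J =>
         if (dlev J <=? dlev I)%nat && in_dyadb J (dleft I) then 1 else 0)).
       change (0 <= stopped_norm X f I) in H; lra. }
  right; rewrite !Rabs_mult, !abs_haar.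
  destruct (in_dyadb (tau I) t) eqn:Et; [| lra].
  rewrite !Rabs_pos_eq; try apply rpow_nonneg; try lra.
  2: { unfold stopped_weight; destruct (Rlt_dec 0 _); [| lra].
       apply Rmult_le_pos; [lra | left; apply Rpower_pos]. }
  unfold stopped_weight; destruct (Rlt_dec 0 (stopped_norm X f I)) as [_ |]; [| lra].
  assert (Hr := dlen_ratio_pos I (tau I)); set (r := dlen I / dlen (tau I)) in *.
  assert (HN : rpow (stopped_norm X f I) q * r <= stopped_mu t).
  { apply (in_map fst) in Hx; simpl in Hx.
    eapply Rle_trans; [| apply (le_maxmap _ _ _ I Hx)]; cbv beta; rewrite Et; apply Rle_refl. }
  apply (rpow_le _ _ _ Hexp) in HN.
  set (s := stopped_norm X f I) in *.
  rewrite (rpow_pos_eq s) in HN by assumption.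
  rewrite rpow_pos_eq in HN by (apply Rmult_lt_0_compat; [apply Rpower_pos | assumption]).
  rewrite <- Rpower_mult_distr, Rpower_mult in HN by (try apply Rpower_pos; assumption).
  rewrite !(rpow_pos_eq r) by assumption.
  set (N := rpow (stopped_mu t) (/ q - / p)) in *.
  apply (Rmult_le_compat_r (Rpower r (/ p) * Rpower s (q / p - 1))) in HN;
    [| apply Rmult_le_pos; left; apply Rpower_pos].
  replace (p / q * N * (1 * (Rpower r (/ p) * (q / p * Rpower s (q / p - 1)))))
    with (N * (Rpower r (/ p) * Rpower s (q / p - 1))) by (field; lra).
  eapply Rle_trans; [| apply HN]; apply Req_le.
  replace (Rpower s (q * (/ q - / p)) * Rpower r (/ q - / p)
           * (Rpower r (/ p) * Rpower s (q / p - 1)))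
    with (Rpower s (q * (/ q - / p)) * Rpower s (q / p - 1)
          * (Rpower r (/ q - / p) * Rpower r (/ p))) by ring.
  rewrite <- !Rpower_plus.
  replace (q * (/ q - / p) + (q / p - 1)) with 0 by (field; lra).
  replace (/ q - / p + / p) with (/ q) by ring.
  rewrite Rpower_O by assumption; reflexivity.
Qed.

(** The layer-cake bound applied to the q-th powers of the stopped norms, whose maximum over the
    intervals through [t] is at most [S(f)(t)^q]. *)
Lemma stopped_mu_int_le M : C1_bound tau M -> Hnorm X q f <= 1 ->
  dyadic_int (S (maxlev (map tau (map fst f)))) stopped_mu <= M.
Proof.
  intros HC Hf; assert (HM := C1_bound_pos _ _ HC).
  rewrite Hnorm_le_iff, rpow_one_l in Hf by lra.
  eapply Rle_trans;
    [apply (C1_bound_layer_cake tau M HC (length f) (map fst f) (fun I => rpow (stopped_norm X f I) q)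
        (S (maxlev (map fst f)))); rewrite ?length_map; auto; intros; apply rpow_nonneg |].
  rewrite <- (Rmult_1_r M) at 2; apply Rmult_le_compat_l; [lra |].
  eapply Rle_trans; [apply dyadic_int_le | apply Hf].
  intros t; cbv beta; apply maxmap_le; [apply rpow_nonneg |].
  intros I _; destruct (in_dyadb I t) eqn:Et; [| apply rpow_nonneg].
  apply rpow_le; [lra | apply stopped_norm_le_Sfun; assumption].
Qed.

Lemma Hnorm_rearr_le M L : C1_bound tau M -> 0 < L -> Hnorm X q f <= 1 ->
  Hnorm X p (rearr X tau p reweighted) <= L ->
  Hnorm X q (rearr X tau q f) <= p / q * Rpower M (/ q - / p) * L.
Proof.
  intros HC HL Hf HT; assert (HM := C1_bound_pos _ _ HC).
  assert (HK : 0 <= p / q * Rpower M (/ q - / p) * L).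
  { apply Rmult_le_pos; [apply Rmult_le_pos |]; try lra; [| left; apply Rpower_pos].
    left; apply Rdiv_lt_0_compat; lra. }
  assert (HN := stopped_mu_int_le M HC Hf).
  rewrite Hnorm_le_iff, rearr_support in * by lra.
  rewrite reweighted_support in HT.
  set (m := S (maxlev (map tau (map fst f)))) in *.
  eapply Rle_trans; [apply dyadic_int_le; intros t |].
  - apply (rpow_young q p _ (stopped_mu t) (Sfun X (rearr X tau p reweighted) t) M L);
      try assumption; [apply maxmap_nonneg | apply sqrt_pos | apply Sfun_rearr_le].
  - set (K := rpow (p / q * Rpower M (/ q - / p) * L) q).
    assert (HLp : 0 < rpow L p) by (rewrite rpow_pos_eq by assumption; apply Rpower_pos).
    set (B := fun t => rpow (Sfun X (rearr X tau p reweighted) t) p) in *.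
    eapply Rle_trans; [apply (dyadic_int_le m _ (fun t =>
      K * ((1 - q / p) / M) * stopped_mu t + K * (q / p / rpow L p) * B t));
      intros t; unfold B; lra |].
    rewrite dyadic_int_lincomb, !Rmult_assoc, <- Rmult_plus_distr_l.
    rewrite <- (Rmult_1_r K) at 2.
    apply Rmult_le_compat_l; [apply rpow_nonneg |].
    apply (Rmult_le_compat_l ((1 - q / p) / M)) in HN; [| apply Rle_mult_inv_pos; lra].
    apply (Rmult_le_compat_l (q / p / rpow L p)) in HT; [| apply Rle_mult_inv_pos; lra].
    (* The two integrals contribute at most [1 - q / p] and [q / p], in total 1. *)
    replace ((1 - q / p) / M * M) with (1 - q / p) in HN by (field; lra).
    replace (q / p / rpow L p * rpow L p) with (q / p) in HT by (field; lra).
    lra.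
Qed.
End Extrapolation.

Theorem theorem1 :
  forall q : R, 0 < q ->
  exists A : R, 0 < A /\
    forall (X : BanachSpace) (tau : dyad -> dyad),
      (forall I J, tau I = tau J -> I = J) ->
      forall p : R, q <= p -> p <= 2 ->
      forall M1 Mp : R,
        C1_bound tau M1 ->
        opbound X tau p Mp ->
        opbound X tau q (A * Rpower M1 (/ q - / p) * Mp).
Proof.
  (* The argument yields the factor [p / q]; [p <= 2] replaces it by a constant free of [p]. *)
  intros q Hq; exists (2 / q); split; [apply Rdiv_lt_0_compat; lra |].
  intros X tau _ p Hqp Hp M1 Mp HC Hop f Hv Hf.
  assert (HT : Hnorm X p (rearr X tau p (reweighted X q p f)) <= Mp).
  { apply Hop; [unfold valid_series; rewrite reweighted_support; assumption |].
    apply Hnorm_reweighted; assumption. }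
  assert (HMp : 0 <= Mp) by (eapply Rle_trans; [apply rpow_nonneg | apply HT]).
  assert (HR := Rpower_pos M1 (/ q - / p)).
  set (K := p / q * Rpower M1 (/ q - / p)).
  assert (HK : 0 < K) by (apply Rmult_lt_0_compat; [apply Rdiv_lt_0_compat; lra | assumption]).
  apply Rle_trans with (K * Mp).
  (* [Hnorm_rearr_le] divides by a power of its bound, while [Mp] may be 0; hence the passage to
     [Mp + e / K]. *)
  - apply le_epsilon; intros e He.
    assert (He' : 0 < e / K) by (apply Rdiv_lt_0_compat; assumption).
    replace (K * Mp + e) with (K * (Mp + e / K)) by (field; lra).
    apply Hnorm_rearr_le; try assumption; lra.
  - apply Rmult_le_compat_r; [assumption |]; unfold K.
    apply Rmult_le_compat_r; [lra |].
    apply Rmult_le_compat_r; [left; apply Rinv_0_lt_compat |]; assumption.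
Qed.
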